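(* Let $m\ge2$ and $\mathbf{z}=(z_{j,i})_{1\le j\le i\le m}$. For $k=2,\dots,m$, $$\sigma_k(\mathbf{z})=\beta_k(\mathbf{z})^{k-2}\,z_{k,k}\sum_{\mathbf{p}\in\mathcal{P}_{k-1}}\mathrm{wt}_{\mathbf{z}}(\mathbf{p}).$$
   Context: The $z_{j,i}$, $1\le j\le i\le m$, are independent variables (or generic nonzero complex numbers). For $1\le j\le m$ let $W^j(y_j,\dots,y_m)=\sum_{l=1}^{j-1}E_{ll}+\sum_{l=j}^m y_lE_{ll}+\sum_{l=j}^{m-1}E_{l+1,l}$ ($m\times m$, $E_{ab}$ matrix units), and $$\Phi_m(\mathbf{z})=W^m(z_{m,m})\cdots W^2\Big(z_{2,2},\tfrac{z_{2,3}}{z_{2,2}},\dots,\tfrac{z_{2,m}}{z_{2,m-1}}\Big)W^1\Big(z_{1,1},\tfrac{z_{1,2}}{z_{1,1}},\dots,\tfrac{z_{1,m}}{z_{1,m-1}}\Big).$$ $\beta_i(\mathbf{z})=\prod_{a=1}^iz_{a,i}\big/\prod_{a=1}^{i-1}z_{a,i-1}$, and for $i=2,\dots,m$ $$\sigma_i(\mathbf{z})=\sum_{X\subseteq\{2,\dots,i-1\}}\beta_i^{\,i-2-|X|}\Delta_{X\cup\{i\},\{1\}\cup X}(\Phi_m(\mathbf{z})),$$ with $\Delta_{A,B}$ the minor with rows $A$ and columns $B$. $\mathcal{P}_{k-1}$ is the set of Gelfand--Tsetlin patterns $\mathbf{p}=(p_{i,j})_{1\le i\le j\le k-1}$ (nonnegative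 integers with $p_{i,j+1}\ge p_{i,j}\ge p_{i+1,j+1}$ whenever $i\le j<k-1$) such that: (1) $p_{i,j}-1\le p_{i+1,j}$ for $i<j$; (2) $p_{i,k-1}-1\le p_{i,i}\le p_{i+1,k-1}$ for $i\le k-2$; (3) $p_{k-1,k-1}=0$. The weight of $\mathbf{p}\in\mathcal{P}_{k-1}$ is $\mathrm{wt}_{\mathbf{z}}(\mathbf{p})=\prod_{1\le i\le j\le k-1}\phi_{k-j,k-i}(\mathbf{z})^{p_{i,j}}$, where $$\phi_{1,j}(\mathbf{z})=\frac{z_{1,j}z_{j,j}}{z_{1,j+1}z_{j+1,j+1}},\qquad \phi_{i,j}(\mathbf{z})=\frac{z_{i-1,j}z_{i,j}}{z_{i-1,j-1}z_{i,j+1}}\quad(i\ge2).$$ *)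

(* Defs.v *)
From HB Require Import structures.
From mathcomp Require Import all_boot all_order all_algebra.
From mathcomp Require Import zify.
Set Implicit Arguments.
Unset Strict Implicit.
Unset Printing Implicit Defensive.
Import GRing.Theory.
Local Open Scope ring_scope.

(* All mathematical indices (of z, of rows and columns, of patterns) start
   at 1: they are natural numbers, and row or column a of an m x m matrix is
   the ordinal r : 'I_m with r.+1 = a. *)

Section Matrices.

Variables (F : fieldType) (m : nat).

Definition Emx (a b : nat) : 'M[F]_m :=
  \matrix_(r < m, c < m) ((r.+1 == a) && (c.+1 == b))%:R.

Definition Wmx (j : nat) (y : nat -> F) : 'M[F]_m :=
  \sum_(1 <= l < j) Emx l l + \sum_(j <= l < m.+1) y l *: Emx l l
  + \sum_(j <= l < m) Emx l.+1 l.

Definition Wcoord (z : nat -> nat -> F) (j i : nat) : F :=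
  if i == j then z j j else z j i / z j i.-1.

(* The factors are listed from W^m down to W^1, and matrices do not commute. *)
Definition Phi (z : nat -> nat -> F) : 'M[F]_m :=
  \prod_(j <- rev (iota 1 m)) Wmx j (Wcoord z j).

(* enum_val and enum list a set of ordinals increasingly.  The minor is
   meant for #|A| = #|B|; the default 0 of nth is then never reached. *)
Definition minor (M : 'M[F]_m) (A B : {set 'I_m}) : F :=
  \det (\matrix_(r < #|A|, c < #|A|)
          nth 0 [seq M (enum_val r) b | b <- enum B] c).

Definition label (a : nat) : {set 'I_m} := [set r : 'I_m | r.+1 == a].

Definition beta (z : nat -> nat -> F) (i : nat) : F :=
  (\prod_(1 <= a < i.+1) z a i) / (\prod_(1 <= a < i) z a i.-1).

(* Here #|X| <= i - 2, so the exponent is a true difference. *)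
Definition sigma (z : nat -> nat -> F) (i : nat) : F :=
  \sum_(X : {set 'I_m} | X \subset [set r : 'I_m | (2 <= r.+1 < i)%N])
     beta z i ^+ (i - 2 - #|X|) *
     minor (Phi z) (X :|: label i) (label 1 :|: X).

End Matrices.

Section Patterns.

Implicit Types (p q : nat -> nat -> nat).

(* p i j is meaningful for 1 <= i <= j <= n *)
Definition GT_pattern (n : nat) p : bool :=
  [forall i : 'I_n.+1, forall j : 'I_n.+1, (0 < i <= j)%N && (j < n)%N ==>
     (p i j <= p i j.+1)%N && (p i.+1 j.+1 <= p i j)%N].

Definition calP_cond (n : nat) p : bool :=
  [&& GT_pattern n p,
      [forall i : 'I_n.+1, forall j : 'I_n.+1, (0 < i < j)%N ==>
         (p i j - 1 <= p i.+1 j)%N],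
      [forall i : 'I_n.+1, (0 < i)%N && (i < n)%N ==>
         (p i n - 1 <= p i i)%N && (p i i <= p i.+1 n)%N] &
      p n n == 0%N].

(* The entries of the patterns satisfying calP_cond n are at most n, so the
   patterns are encoded in the finite type of arrays below, extended by 0
   outside the triangle.  The lemmas calP_complete and calP_inj show that
   calP n is in bijection with the patterns having arbitrary entries in nat. *)
Definition array (n : nat) := {ffun 'I_n.+1 * 'I_n.+1 -> 'I_n.+1}.

Definition entry (n : nat) (p : array n) (i j : nat) : nat :=
  p (inord i, inord j).

Definition calP (n : nat) : {set array n} :=
  [set p : array n | calP_cond n (entry p) &&
     [forall i : 'I_n.+1, forall j : 'I_n.+1,
        ~~ (0 < i <= j)%N ==> (entry p i j == 0%N)]].

Lemma calP_condP (n : nat) p : reflect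
  [/\ forall i j, (0 < i <= j)%N -> (j < n)%N ->
        (p i j <= p i j.+1)%N /\ (p i.+1 j.+1 <= p i j)%N,
      forall i j, (0 < i < j)%N -> (j <= n)%N -> (p i j - 1 <= p i.+1 j)%N,
      forall i, (0 < i < n)%N ->
        (p i n - 1 <= p i i)%N /\ (p i i <= p i.+1 n)%N &
      p n n = 0%N]
  (calP_cond n p).
Proof.
apply: (iffP and4P) => [[/forallP h1 /forallP h2 /forallP h3 /eqP h4]|].
  split=> // [i j hij hj|i j hij hj|i hi].
  - have hi' : (i < n.+1)%N by lia.
    have hj' : (j < n.+1)%N by lia.
    have /forallP/(_ (Ordinal hj'))/= := h1 (Ordinal hi').
    by rewrite hij hj => /andP.
  - have hi' : (i < n.+1)%N by lia.
    have hj' : (j < n.+1)%N by lia.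
    have /forallP/(_ (Ordinal hj'))/= := h2 (Ordinal hi').
    by rewrite hij.
  - have hi' : (i < n.+1)%N by lia.
    by have := h3 (Ordinal hi'); rewrite /= hi => /andP.
move=> [h1 h2 h3 h4]; split; last by apply/eqP.
- apply/forallP=> i; apply/forallP=> j; apply/implyP=> /andP[hij hj].
  by apply/andP; apply: h1.
- apply/forallP=> i; apply/forallP=> j; apply/implyP=> hij.
  by apply: h2 => //; rewrite -ltnS.
- by apply/forallP=> i; apply/implyP=> hi; apply/andP; apply: h3.
Qed.

Lemma calP_cond_bound (n : nat) p (i j : nat) :
  calP_cond n p -> (0 < i <= j)%N -> (j <= n)%N -> (p i j <= n - i)%N.
Proof.
move=> /calP_condP[h1 h2 h3 h4] hij hjn.
have last_col d : (d < n)%N -> (p (n - d)%N n <= d)%N.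
  elim: d => [|d IHd] hd; first by rewrite subn0 h4.
  have [] := h3 (n - d.+1)%N; first by lia.
  have -> : (n - d.+1).+1 = (n - d)%N by lia.
  by have := IHd ltac:(lia); lia.
have row d : (i <= n - d)%N -> (p i (n - d)%N <= p i n)%N.
  elim: d => [|d IHd] hd; first by rewrite subn0.
  have [] := h1 i (n - d.+1)%N; [lia|lia|].
  have -> : (n - d.+1).+1 = (n - d)%N by lia.
  by have := IHd ltac:(lia); lia.
have := row (n - j)%N; have := last_col (n - i)%N.
have -> : (n - (n - j) = j)%N by lia.
have -> : (n - (n - i) = i)%N by lia.
lia.
Qed.

Lemma calP_cond_ext (n : nat) p q : (0 < n)%N ->
  (forall i j, (0 < i <= j)%N -> (j <= n)%N -> p i j = q i j) ->
  calP_cond n p -> calP_cond n q.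
Proof.
move=> n0 e /calP_condP[h1 h2 h3 h4]; apply/calP_condP; split.
- by move=> i j hij hj; have := h1 i j hij hj; rewrite !e //; lia.
- by move=> i j hij hj; have := h2 i j hij hj; rewrite !e //; lia.
- by move=> i hi; have := h3 i hi; rewrite !e //; lia.
- by rewrite -e //; lia.
Qed.

Lemma calP_complete (n : nat) q : (0 < n)%N -> calP_cond n q ->
  exists2 p : array n, p \in calP n &
    forall i j, (0 < i <= j)%N -> (j <= n)%N -> entry p i j = q i j.
Proof.
move=> n0 hq.
pose p : array n := [ffun ij : 'I_n.+1 * 'I_n.+1 =>
  inord (if (0 < ij.1 <= ij.2)%N then q ij.1 ij.2 else 0%N)].
have pE i j : (0 < i <= j)%N -> (j <= n)%N -> entry p i j = q i j.
  move=> hij hj; rewrite /entry ffunE /= !inordK ?hij //; try lia.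
  by have := calP_cond_bound hq hij hj; lia.
exists p => //; rewrite inE; apply/andP; split.
  by apply: calP_cond_ext hq => // i j hij hj; rewrite pE.
apply/forallP=> i; apply/forallP=> j; apply/implyP=> /negbTE hij.
by rewrite /entry ffunE /= !inord_val hij inordK.
Qed.

Lemma calP_inj (n : nat) (p q : array n) : p \in calP n -> q \in calP n ->
  (forall i j, (0 < i <= j)%N -> (j <= n)%N -> entry p i j = entry q i j) ->
  p = q.
Proof.
rewrite !inE => /andP[_ /forallP hp] /andP[_ /forallP hq] e.
apply/ffunP=> -[i j]; apply: ord_inj.
have entryE (r : array n) : entry r i j = r (i, j).
  by rewrite /entry !inord_val.
rewrite -!entryE; have [hij|hij] := boolP (0 < i <= j)%N.
  by apply: e => //; rewrite -ltnS.
have /forallP/(_ j) := hp i; have /forallP/(_ j) := hq i.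
by rewrite hij /= => /eqP-> /eqP->.
Qed.

End Patterns.

Section Weights.

Variables (F : fieldType) (z : nat -> nat -> F).

Definition phi (i j : nat) : F :=
  if i == 1%N then z 1 j * z j j / (z 1 j.+1 * z j.+1 j.+1)
  else z i.-1 j * z i j / (z i.-1 j.-1 * z i j.+1).

Definition wt (k : nat) (p : array k.-1) : F :=
  \prod_(1 <= i < k) \prod_(i <= j < k) phi (k - j) (k - i) ^+ entry p i j.

End Weights.

(* Main.v *)
Require Import Defs.
From mathcomp Require Import all_boot all_order all_algebra.
From mathcomp Require Import zify ring.
Set Implicit Arguments.
Unset Strict Implicit.
Unset Printing Implicit Defensive.
Import GRing.Theory.
Local Open Scope ring_scope.

(* Both sides count walks on a cylinder.  Put y a l = Wcoord z a l.  A walker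
   visits the positions 1, ..., k in this order while the time runs cyclically
   through the factors W^1, W^2, ...; at time a it either stays at its position
   l, with weight y a l (1 if a > l), or steps to l + 1, which requires a <= l.
   A position in {2, ..., k - 1} at which it does not pass the time seam
   contributes a factor x.  At x = beta_k both sides equal the walk sum.
   - Expanding the Hessenberg minors of Phi along their last column turns
     sigma_k into S_k, where S_{n+1}(f) = (x - beta_n) S_n(f) + f(n) S_n(Phi_n)
     for every row f, Phi_n being row n of Phi; the walk sum satisfies the same
     recurrence.
   - Writing s_l <= l for the time at which the walker leaves l, row k - l of a
     pattern is determined by s_l and the number a_l of seams crossed up to
     that exit: p_(k-l,k-b) = a_l - [b > s_l].  This is a bijection onto
     calP (k - 1), and a telescoping of the phi_(b,l) matches the weights. *)

(** * Determinants of Hessenberg matrices *)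

Section Hessenberg.

Variable R : comNzRingType.

(** The last row f is kept free, so that both minors in the expansion [hessS] have this form
    again. *)
Definition hess (A : nat -> nat -> R) (n : nat) (f : nat -> R) : R :=
  \det (\matrix_(i < n.+1, j < n.+1) if (i < n)%N then A i j else f j).

Lemma hess0 A f : hess A 0 f = f 0.
Proof. by rewrite /hess det_mx11 mxE. Qed.

(** Only the last two rows meet the last column, so its Laplace expansion has two terms; deleting
    the row f makes [A n] the last row. *)
Lemma hessS A n f :
  (forall i, (i < n)%N -> A i n.+1 = 0) ->
  hess A n.+1 f = f n.+1 * hess A n (A n) - A n n.+1 * hess A n f.
Proof.
move=> A0; rewrite /hess (expand_det_col _ ord_max).
rewrite big_ord_recr big_ord_recr /= big1 ?add0r; last first.
  move=> i _; rewrite mxE /=; rewrite ltnS ltnW ?ltn_ord //.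
  by rewrite A0 // mul0r.
rewrite addrC !mxE /= ltnn ltnSn; congr (_ * _ + _).
  rewrite /cofactor /= addnn -mul2n exprM sqrrN expr1n expr1n mul1r.
  congr (\det _); apply/matrixP=> i j; rewrite !mxE /= /bump.
  have := ltn_ord i; have := ltn_ord j => ? ?.
  have -> : (n.+1 <= i)%N = false by lia.
  have -> : (n.+1 <= j)%N = false by lia.
  rewrite !add0n ltnS; have -> : (i <= n)%N by lia.
  case: ltnP => // h; have -> // : i = n :> nat by lia.
rewrite /cofactor /= addnS addnn exprS -mul2n exprM sqrrN expr1n expr1n.
rewrite mulr1 mulN1r mulrN; congr (- (_ * \det _)).
apply/matrixP=> i j; rewrite !mxE /= /bump.
have := ltn_ord i; have := ltn_ord j => ? ?.
have -> : (n.+1 <= j)%N = false by lia.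
rewrite add0n; case: (ltnP i n) => h.
  by rewrite add0n ltnS ltnW.
by rewrite add1n ltnS ltnNge h.
Qed.

Variable M : nat -> nat -> R.
Hypothesis M0 : forall i j, (i < j)%N -> M i j = 0.

(** Rows u, f against columns 1, u: for lower triangular M and increasing u this shift makes the
    matrix Hessenberg. *)
Definition chain_det (u : seq nat) (f : nat -> R) : R :=
  hess (fun i j => M (nth 0%N u i) (nth 0%N (1%N :: u) j)) (size u)
       (fun j => f (nth 0%N (1%N :: u) j)).

Lemma chain_det_nil f : chain_det [::] f = f 1%N.
Proof. exact: hess0. Qed.

Lemma chain_det_rcons u a f : sorted ltn (rcons u a) ->
  chain_det (rcons u a) f = f a * chain_det u (M a) - M a a * chain_det u f.
Proof.
move=> su; rewrite /chain_det size_rcons hessS; last first.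
  move=> i hi; apply: M0; rewrite /=.
  by apply: (sorted_ltn_nth ltn_trans) => //; rewrite inE size_rcons; lia.
have nE i : (i < (size u).+1)%N ->
    nth 0%N (1%N :: rcons u a) i = nth 0%N (1%N :: u) i.
  case: i => //= i hi; rewrite nth_rcons; case: ltngtP => //; lia.
rewrite /= !nth_rcons ltnn eqxx; congr (_ * _ - _ * _); congr (\det _);
  apply/matrixP=> i j; rewrite !mxE !nE //.
  by rewrite nth_rcons; case: (ltnP i (size u)).
by rewrite nth_rcons; case: (ltnP i (size u)).
Qed.

End Hessenberg.

(** * Sums over subsets and their recurrence *)

Section Subsets.
Variables (R : comNzRingType) (M : nat -> nat -> R).
Hypothesis M0 : forall i j, (i < j)%N -> M i j = 0.
Variables (m : nat) (x : R).

Definition labels (X : {set 'I_m}) : seq nat := [seq (val i).+1 | i <- enum X].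

Lemma labels_sorted X : sorted ltn (labels X).
Proof.
rewrite /labels (map_comp S val) sorted_map.
rewrite sorted_map /enum_mem /=.
apply: sorted_filter; first by move=> a b c; apply: ltn_trans.
have := iota_ltn_sorted 0 m.
by rewrite -val_enum_ord sorted_map enumT.
Qed.

Lemma mem_labels X a : (a \in labels X) = [exists i in X, (val i).+1 == a].
Proof.
apply/mapP/existsP => [[i]|[i /andP[iX /eqP<-]]]; last first.
  by exists i => //; rewrite mem_enum.
by rewrite mem_enum => iX ->; exists i; rewrite iX eqxx.
Qed.

Lemma labels_setU1 (o : 'I_m) (X : {set 'I_m}) :
  (forall i, i \in X -> (i < o)%N) ->
  labels (o |: X) = rcons (labels X) o.+1.
Proof.
move=> ltXo; apply: (irr_sorted_eq ltn_trans ltnn (labels_sorted _)).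
  have := labels_sorted X; rewrite -cats1.
  case E : (labels X) => [//|a l] /= sl; rewrite cat_path sl /= andbT.
  have: last a l \in labels X by rewrite E mem_last.
  rewrite mem_labels => /existsP[i /andP[iX /eqP <-]].
  by rewrite ltnS ltXo.
move=> a; rewrite mem_rcons inE !mem_labels.
apply/existsP/orP => [[i]|].
  rewrite !inE => /andP[/orP[/eqP->|iX] ia]; first by left; rewrite eq_sym.
  by right; apply/existsP; exists i; rewrite iX.
case=> [/eqP->|/existsP[i /andP[iX ia]]].
  by exists o; rewrite !inE !eqxx.
by exists i; rewrite !inE iX orbT.
Qed.

(** This is S_n(f); f is arbitrary because the recurrence also evaluates it at row n of M. *)
Definition subset_sum (n : nat) (f : nat -> R) : R :=
  \sum_(X : {set 'I_m} | X \subset [set r : 'I_m | (2 <= r.+1 < n)%N])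
     x ^+ (n - 2 - #|X|) * chain_det M (labels X) f.

Lemma subset_sum2 f : subset_sum 2 f = f 1%N.
Proof.
rewrite /subset_sum (big_pred1 set0) => [|X].
  by rewrite cards0 /labels enum_set0 chain_det_nil mul1r.
have -> : [set r : 'I_m | (2 <= r.+1 < 2)%N] = set0.
  by apply/setP=> i; rewrite !inE; lia.
by rewrite subset0.
Qed.

(** A subset without n gains one factor x; from a subset with n, [chain_det_rcons] splits off n. *)
Lemma subset_sumS n f : (2 <= n <= m)%N ->
  subset_sum n.+1 f = (x - M n n) * subset_sum n f + f n * subset_sum n (M n).
Proof.
move=> /andP[n2 nm].
have on : (n.-1 < m)%N by lia.
pose o := Ordinal on.
pose I := [set r : 'I_m | (2 <= r.+1 < n)%N].
have card_sub (X : {set 'I_m}) : X \subset I -> (#|X| <= n - 2)%N.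
  move=> /subsetP XI; rewrite cardE -(size_map (fun i => (val i).+1)).
  rewrite -(size_iota 2 (n - 2)) uniq_leq_size //.
    by rewrite (sorted_uniq ltn_trans ltnn) ?labels_sorted.
  move=> a /mapP[i]; rewrite mem_enum => /XI; rewrite inE => hi ->.
  by rewrite mem_iota /=; lia.
have oI : o \notin I by rewrite !inE /=; lia.
have IE : [set r : 'I_m | (2 <= r.+1 < n.+1)%N] = o |: I.
  by apply/setP=> i; rewrite !inE -val_eqE /=; lia.
have ltI (X : {set 'I_m}) : X \subset I -> forall i, i \in X -> (i < o)%N.
  by move=> /subsetP XI i /XI; rewrite !inE /=; lia.
rewrite {1}/subset_sum IE (bigID (fun X : {set 'I_m} => o \in X)) /= addrC.
rewrite mulrBl -addrA -{1}/I; congr (_ + _).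
  rewrite /subset_sum mulr_sumr; apply: eq_big => X.
    by rewrite -subsetD1 setU1K.
  move=> /andP[XoI oX]; rewrite mulrA -exprS; congr (x ^+ _ * _).
  have /card_sub : X \subset I by rewrite -(setU1K oI) subsetD1 XoI.
  by set c := #|X|; lia.
rewrite (reindex_onto (fun X => o |: X) (fun X => X :\ o)) /=; last first.
  by move=> X /andP[_ oX]; rewrite setD1K.
rewrite -mulNr /subset_sum -/I !mulr_sumr -big_split /=.
apply: eq_big => X.
  rewrite setU11 andbT; apply/andP/idP => [[h /eqP e]|XI].
    by rewrite -e -(setU1K oI) setSD.
  rewrite setUS // setU1K //; apply/negP => oX; case/negP: oI.
  exact: (subsetP XI).
move=> /andP[/andP[h _] /eqP e].
have XI : X \subset I by rewrite -e -(setU1K oI) setSD.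
have oX : o \notin X by rewrite -e !inE eqxx.
rewrite cardsU1 oX labels_setU1; last exact: ltI XI.
have -> : (n.+1 - 2 - (true + #|X|) = n - 2 - #|X|)%N by lia.
rewrite chain_det_rcons //; first last.
  by rewrite -labels_setU1 ?labels_sorted //; apply: ltI XI.
have -> : o.+1 = n by rewrite /=; lia.
ring.
Qed.

End Subsets.

(** * Walks on the cylinder and lattice paths *)

Section Cylinder.

Variables (R : comNzRingType) (y : nat -> nat -> R) (x : R).

Definition colprod (l : nat) : R := \prod_(1 <= a < l.+1) y a l.

(* The weight of position l for a walker that arrives there at time s' and
   leaves at time s; it passes the seam meanwhile exactly when s <= s'. *)
Definition transfer (l s' s : nat) : R :=
  if (s <= s')%N then
    (\prod_(1 <= a < s) y a l) * \prod_(s'.+1 <= a < l.+1) y a l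
  else x * \prod_(s'.+1 <= a < s) y a l.

(* Indices are shifted: walks l s is the sum over the walks that leave position
   l + 1 at time s. *)
Fixpoint walks (l s : nat) : R :=
  if l is l'.+1 then
    \sum_(1 <= s' < l'.+2) walks l' s' * transfer l'.+2 s' s
  else 1.

Arguments walks : simpl never.

Lemma walks_rec l s :
  walks l.+1 s = \sum_(1 <= s' < l.+2) walks l s' * transfer l.+2 s' s.
Proof. by []. Qed.

(* Entry (l, c) of the product W^s ... W^1. *)
Fixpoint paths (s l c : nat) : R :=
  if s is s'.+1 then
    (if (s <= l)%N then y s l else 1) * paths s' l c +
    (if (s < l)%N then paths s' l.-1 c else 0)
  else (l == c)%:R.

Lemma paths_small s l c : (l < c)%N -> paths s l c = 0.
Proof.
elim: s l => [|s IHs] l lc /=; first by case: eqP => // e; lia.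
rewrite IHs // mulr0 add0r; case: ifP => // sl; apply: IHs; lia.
Qed.

Lemma paths_diag s l : (s <= l)%N -> paths s l l = \prod_(1 <= a < s.+1) y a l.
Proof.
elim: s => [|s IHs] sl /=; first by rewrite eqxx big_geq.
rewrite sl IHs ?(ltnW sl) // [RHS]big_nat_recr //= mulrC.
by case: ifP => h; rewrite ?addr0 // paths_small ?addr0 //; lia.
Qed.

(** The index s' is the time of the last step, from l to l + 1. *)
Lemma paths_last s l c : (s <= l)%N -> (c <= l)%N ->
  paths s l.+1 c =
    \sum_(1 <= s' < s.+1) paths s'.-1 l c * \prod_(s'.+1 <= a < s.+1) y a l.+1.
Proof.
move=> sl cl; elim: s sl => [|s IHs] sl.
  by rewrite [RHS]big_geq //=; case: eqP => // e; lia.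
rewrite big_nat_recr //= (big_geq (leqnn _)) mulr1.
rewrite ltnW // ltnS sl IHs ?(ltnW sl) // mulr_sumr; congr (_ + _).
apply: eq_big_nat => s' hs'.
by rewrite [in RHS]big_nat_recr //= ?mulrA; [ring | lia].
Qed.

Lemma paths_stable s d l c : (l <= s)%N -> paths (s + d) l c = paths s l c.
Proof.
move=> ls; elim: d => [|d IHd]; first by rewrite addn0.
rewrite addnS /=; have -> : (s + d < l)%N = false by lia.
have -> : ((s + d).+1 < l)%N = false by lia.
by rewrite mul1r addr0 IHd.
Qed.

(** Delaying the exit adds a factor [y s l], except when the exit passes the arrival time s': a full
    turn of weight [colprod l] is then replaced by a stay of weight x. *)
Lemma transferS l s' s : (1 <= s' < l)%N -> (1 <= s < l)%N ->
  transfer l s' s.+1 =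
    y s l * transfer l s' s + (if s' == s then x - colprod l else 0).
Proof.
move=> /andP[s'0 s'l] /andP[s0 sl]; rewrite /transfer /colprod.
case: (ltngtP s' s) => ss'.
- by rewrite addr0 big_nat_recr //=; ring.
- by rewrite addr0 [in LHS]big_nat_recr //=; ring.
rewrite ss' big_geq // [X in x - X](big_cat_nat _ (n := s.+1)) //= 1?ltnW //.
by rewrite [X in x - X * _]big_nat_recr //=; ring.
Qed.

Lemma walksS l s : (1 <= s <= l.+1)%N ->
  walks l.+1 s.+1 = y s l.+2 * walks l.+1 s + (x - colprod l.+2) * walks l s.
Proof.
move=> hs; rewrite !walks_rec mulr_sumr.
rewrite (eq_big_nat _ _ (F2 := fun s' => y s l.+2 * (walks l s' * transfer l.+2 s' s)
   + (if s' == s then (x - colprod l.+2) * walks l s else 0))); last first.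
  move=> s' hs'; rewrite transferS //; try lia.
  by case: eqP => [->|_]; ring.
rewrite big_split /=; congr (_ + _).
rewrite -big_mkcond /= big_nat1_eq.
by have -> : (0 < s < l.+2)%N by lia.
Qed.

(* A walk that stays at position i during a whole turn of the cylinder has
   weight colprod i instead of x, and must be discarded.  This gives the factors
   x - colprod i when a walk is compared with the path it follows after its last
   passage through the seam, which happens at position c. *)
Lemma walks_paths l s : (1 <= s <= l.+1)%N ->
  walks l s = \sum_(1 <= c < l.+2) paths s.-1 l.+1 c * walks c.-1 1 *
                \prod_(c.+1 <= i < l.+2) (x - colprod i).
Proof.
elim: l s => [|l IHl] s hs.
  have -> : s = 1%N by lia.
  by rewrite big_nat1 big_geq //= mulr1 mul1r.
elim: s hs => [//|[|s] IHs] hs.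
  rewrite big_nat_recr //= big1_seq ?add0r; last first.
    move=> c /andP[_]; rewrite mem_index_iota => hc.
    have -> : (l.+2 == c) = false by lia.
    by rewrite !mul0r.
  by rewrite eqxx mul1r [X in _ * X]big_geq // mulr1.
have hs2 : (s.+1 < l.+2)%N by lia.
rewrite walksS; last by lia.
rewrite IHs ?IHl; try lia.
rewrite big_nat_recr //= [in RHS]big_nat_recr //= !(big_geq (leqnn _)).
rewrite ltnW // hs2 [in RHS](paths_small _ (leqnn _)) addr0 mulrDr -addrA.
rewrite [X in _ + X]addrC addrA !mulr1 !mulrA; congr (_ + _).
rewrite !mulr_sumr -big_split; apply: eq_big_nat => c hc /=.
rewrite big_nat_recr /=; last by lia.
ring.
Qed.

(** An exit at time 1 has always passed the seam, so the last transfer contains no x, and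
    [paths_last] merges it with the path before it into an entry of row l + 2 of Phi. *)
Lemma walks_hessenberg l :
  walks l.+1 1 = \sum_(1 <= c < l.+2) paths l.+2 l.+2 c * walks c.-1 1 *
                \prod_(c.+1 <= i < l.+2) (x - colprod i).
Proof.
rewrite walks_rec; rewrite (eq_big_nat _ _ (F2 := fun s' => \sum_(1 <= c < l.+2)
    paths s'.-1 l.+1 c * walks c.-1 1 *
    \prod_(c.+1 <= i < l.+2) (x - colprod i) * transfer l.+2 s' 1)); last first.
  by move=> s' hs'; rewrite walks_paths ?mulr_suml.
rewrite exchange_big; apply: eq_big_nat => c hc.
(* [paths_last] requires a time below the position, hence time l + 2 is split off. *)
have -> : paths l.+2 l.+2 c = y l.+2 l.+2 * paths l.+1 l.+2 c.
  by rewrite /= !ltnn !addr0 !leqnn.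
rewrite paths_last; try lia.
rewrite mulr_sumr !mulr_suml; apply: eq_big_nat => s' hs'.
rewrite /transfer; have -> : (0 < s')%N by lia.
rewrite (big_geq (leqnn _)) [X in _ * (_ * X)]big_nat_recr /=; last by lia.
ring.
Qed.

End Cylinder.

(** * The subset sum as a sum over walks *)

Lemma labels_set1U (m : nat) (o : 'I_m) (X : {set 'I_m}) :
  (forall i, i \in X -> (o < i)%N) -> labels (o |: X) = o.+1 :: labels X.
Proof.
move=> ltoX; apply: (irr_sorted_eq ltn_trans ltnn (labels_sorted _)).
  rewrite /= path_min_sorted ?labels_sorted //.
  apply/allP=> a; rewrite mem_labels => /existsP[i /andP[iX /eqP <-]].
  by rewrite ltnS ltoX.
move=> a; rewrite inE !mem_labels.
apply/existsP/orP => [[i]|].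
  rewrite !inE => /andP[/orP[/eqP->|iX] ia]; first by left; rewrite eq_sym.
  by right; apply/existsP; exists i; rewrite iX.
case=> [/eqP->|/existsP[i /andP[iX ia]]].
  by exists o; rewrite !inE !eqxx.
by exists i; rewrite !inE iX orbT.
Qed.

(** This solves the recurrence [subset_sumS]: old terms gain x - colprod n, and the coefficient
    S_n(Phi_n) of f n is a walk sum by [walks_hessenberg]. *)
Lemma subset_sum_walks (R : comNzRingType) (y : nat -> nat -> R) (x : R)
    (m n : nat) (f : nat -> R) : (2 <= n <= m.+1)%N ->
  subset_sum (paths y m) m x n f =
    \sum_(1 <= c < n) f c * walks y x c.-1 1 *
      \prod_(c.+1 <= i < n) (x - colprod y i).
Proof.
elim: n f => [//|[//|[_ f _|n IHn f hn]]].
  by rewrite subset_sum2 big_nat1 big_geq //= !mulr1.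
have pathsm c l : (l <= m)%N -> paths y m l c = paths y l l c.
  by move=> lm; rewrite -(subnKC lm) paths_stable.
rewrite subset_sumS; [|by move=> i j ?; apply: paths_small|lia].
rewrite [RHS]big_nat_recr //= [X in _ = _ + X * _](_ : _ = f n.+2 * walks y x n.+1 1) //.
rewrite (big_geq (leqnn _)) mulr1; congr (_ + _).
  rewrite pathsm ?paths_diag -/(colprod _ _); try lia.
  rewrite IHn ?mulr_sumr; last lia.
  apply: eq_big_nat => c hc.
  by rewrite [in RHS]big_nat_recr /=; [ring | lia].
rewrite IHn ?walks_hessenberg; last lia.
by congr (_ * _); apply: eq_big_nat => c hc; rewrite pathsm; last lia.
Qed.

(** * Entries and minors of Phi *)

Section PhiEntries.

Variables (F : fieldType) (m : nat).

Lemma sum_Emx (g : nat -> F) (d i j : nat) (r c : 'I_m) :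
  (\sum_(i <= l < j) g l *: Emx F m (l + d)%N l) r c =
  if (r == (c + d)%N :> nat) && (i <= c.+1 < j)%N then g c.+1 else 0.
Proof.
rewrite summxE.
rewrite (eq_bigr (fun l => if l == c.+1 then
   (if r == (c + d)%N :> nat then g c.+1 else 0) else 0)); last first.
  move=> l _; rewrite !mxE [c.+1 == l]eq_sym; case: (eqVneq l) => [->|_]; last first.
    by rewrite andbF mulr0.
  by rewrite addSn eqSS andbT; case: eqP; rewrite ?mulr1 ?mulr0.
by rewrite -big_mkcond big_nat1_eq /=; case: eqP; case: ifP.
Qed.

Lemma WmxE (j : nat) (y : nat -> F) (r c : 'I_m) : (0 < j)%N ->
  Wmx m j y r c =
    (if r == c :> nat then if (j <= r.+1)%N then y r.+1 else 1 else 0) +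
    (if (r == c.+1 :> nat) && (j <= r)%N then 1 else 0).
Proof.
move=> j0; rewrite /Wmx 2!mxE.
have E (i i' d : nat) : \sum_(i <= l < i') Emx F m (l + d)%N l =
    \sum_(i <= l < i') 1 *: Emx F m (l + d)%N l.
  by apply: eq_bigr => l _; rewrite scale1r.
have -> : \sum_(1 <= l < j) Emx F m l l = \sum_(1 <= l < j) Emx F m (l + 0)%N l.
  by apply: eq_bigr => l _; rewrite addn0.
have -> : \sum_(j <= l < m.+1) y l *: Emx F m l l =
          \sum_(j <= l < m.+1) y l *: Emx F m (l + 0)%N l.
  by apply: eq_bigr => l _; rewrite addn0.
have -> : \sum_(j <= l < m) Emx F m l.+1 l =
          \sum_(j <= l < m) Emx F m (l + 1)%N l.
  by apply: eq_bigr => l _; rewrite addn1.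
rewrite !E !sum_Emx addn0 addn1; have := ltn_ord c; have := ltn_ord r => rm cm.
congr (_ + _); last first.
  by case: eqP => //= e; congr (if _ then _ else _); lia.
case: eqP => /= [->|_]; last by rewrite addr0.
have -> : (c.+1 < m.+1)%N by lia.
by rewrite andbT; case: leqP; rewrite ?addr0 ?add0r //=.
Qed.

Lemma Wmx_paths (z : nat -> nat -> F) (s : nat) :
  Wmx m s.+1 (Wcoord z s.+1) *m (\matrix_(r < m, c < m) paths (Wcoord z) s r.+1 c.+1)
  = \matrix_(r < m, c < m) paths (Wcoord z) s.+1 r.+1 c.+1.
Proof.
apply/matrixP=> r c; rewrite !mxE.
under eq_bigr => k _ do rewrite WmxE // mxE mulrDl.
rewrite big_split /=; congr (_ + _).
  rewrite (bigD1 r) //= eqxx big1 ?addr0 // => k kr.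
  by rewrite eq_sym val_eqE (negbTE kr) mul0r.
rewrite [in RHS]ltnS; case: ltnP => [sr|sr]; last first.
  by rewrite big1 // => k _; rewrite andbF mul0r.
have r1 : (r.-1 < m)%N by have := ltn_ord r; lia.
rewrite (bigD1 (Ordinal r1)) //= big1 ?addr0 => [|k kr].
  have -> : (r == r.-1.+1 :> nat) by lia.
  have -> : r.-1.+1 = r by lia.
  by rewrite mul1r.
have -> : (r == k.+1 :> nat) = false.
  by apply: contraNF kr => /eqP e; rewrite -val_eqE /= e.
by rewrite mul0r.
Qed.

Lemma PhiE (z : nat -> nat -> F) (r c : 'I_m) :
  Phi m z r c = paths (Wcoord z) m r.+1 c.+1.
Proof.
have H s : \prod_(j <- rev (iota 1 s)) Wmx m j (Wcoord z j) =
    \matrix_(r < m, c < m) paths (Wcoord z) s r.+1 c.+1.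
  elim: s => [|s IHs].
    by rewrite big_nil; apply/matrixP=> i j; rewrite !mxE /= eqSS.
  have -> : iota 1 s.+1 = rcons (iota 1 s) s.+1.
    by rewrite -(addn1 s) iotaD cats1 addnC.
  by rewrite rev_rcons big_cons IHs -Wmx_paths.
by rewrite /Phi H mxE.
Qed.

Lemma minor_labels (N : nat -> nat -> F) (M : 'M[F]_m) (A B : {set 'I_m}) :
  (forall r c, M r c = N r.+1 c.+1) -> #|A| = #|B| ->
  minor M A B = \det (\matrix_(i < #|A|, j < #|A|)
    N (nth 0%N (labels A) i) (nth 0%N (labels B) j)).
Proof.
move=> ME AB; congr (\det _); apply/matrixP=> i j; rewrite !mxE.
have x0 : 'I_m by exact: enum_val i.
have hi : (i < size (enum A))%N by rewrite -cardE.
have hj : (j < size (enum B))%N by rewrite -cardE -AB.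
by rewrite (nth_map x0) // !(nth_map x0) // -(enum_val_nth x0) -ME.
Qed.

(** As 1 lies below X and k above it, the rows in order are X, k and the columns 1, X. *)
Lemma minor_chain_det (N : nat -> nat -> F) (M : 'M[F]_m) (k : nat)
    (X : {set 'I_m}) : (2 <= k <= m)%N ->
  (forall r c, M r c = N r.+1 c.+1) ->
  X \subset [set r : 'I_m | (2 <= r.+1 < k)%N] ->
  minor M (X :|: label m k) (label m 1 :|: X) = chain_det N (labels X) (N k).
Proof.
move=> hk ME /subsetP XI.
have k1 : (k.-1 < m)%N by lia.
have m0 : (0 < m)%N by lia.
have XI' i : i \in X -> (2 <= i.+1 < k)%N by move=> /XI; rewrite inE.
have -> : label m k = [set Ordinal k1].
  by apply/setP=> i; rewrite !inE -val_eqE /=; lia.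
have -> : label m 1 = [set Ordinal m0].
  by apply/setP=> i; rewrite !inE -val_eqE /=; lia.
rewrite setUC.
have lA : labels (Ordinal k1 |: X) = rcons (labels X) k.
  rewrite labels_setU1 => [|i /XI'] /=; last lia.
  by rewrite prednK //; lia.
have lB : labels (Ordinal m0 |: X) = 1%N :: labels X.
  by rewrite labels_set1U => [//|i /XI'] /=; lia.
have card (Y : {set 'I_m}) : #|Y| = size (labels Y) by rewrite size_map cardE.
rewrite (minor_labels ME); last by rewrite !card lA lB size_rcons.
rewrite card lA lB size_rcons /chain_det /hess; congr (\det _).
apply/matrixP=> i j; rewrite !mxE nth_rcons; case: ifP => // h.
by have := ltn_ord i; case: ifP => // h' ; lia.
Qed.

Lemma sigma_walks (z : nat -> nat -> F) (k : nat) : (2 <= k <= m)%N ->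
  sigma m z k = walks (Wcoord z) (beta z k) k.-1 1.
Proof.
move=> hk.
have -> : sigma m z k =
    subset_sum (paths (Wcoord z) m) m (beta z k) k (paths (Wcoord z) m k).
  apply: eq_bigr => X XI; congr (_ * _).
  by apply: minor_chain_det => // r c; apply: PhiE.
rewrite subset_sum_walks; last by lia.
case: k hk => [//|[//|k]] hk; rewrite walks_hessenberg.
apply: eq_big_nat => c _.
have le : (k.+2 <= m)%N by lia.
by rewrite -{1}(subnKC le) paths_stable.
Qed.

End PhiEntries.

(** * The bijection between exit times and patterns *)

Section ExitTimes.

(* Exit times are listed as [:: s_l; ...; s_1], the last position first. *)
Fixpoint exits (l : nat) : seq (seq nat) :=
  if l is l'.+1 then [seq s :: u | u <- exits l', s <- iota 1 l'.+1]
  else [:: [::]].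

Arguments exits : simpl never.

Fixpoint is_exits (u : seq nat) : bool :=
  if u is s :: u' then (0 < s <= (size u').+1)%N && is_exits u' else true.

(** This is a_l: position i > 1 counts when s_i <= s_(i-1), that is when the walker passes the seam
    there. *)
Fixpoint wraps (u : seq nat) : nat :=
  if u is s :: u' then
    ((if u' is s' :: _ then (s <= s')%N : nat else 0) + wraps u')%N
  else 0%N.

Lemma exitsS l : exits l.+1 = [seq s :: u | u <- exits l, s <- iota 1 l.+1].
Proof. by []. Qed.

Lemma mem_exits l u : (u \in exits l) = (size u == l) && is_exits u.
Proof.
elim: l u => [|l IHl] u; first by rewrite mem_seq1; case: u.
rewrite exitsS.
apply/allpairsPdep/andP => [[w [s [wl sl ->]]]|[]].
  move: wl sl; rewrite IHl (mem_iota 1 l.+1) => /andP[/eqP <- ew].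
  by rewrite /= eqxx ew andbT add1n ltnS.
case: u => [//|s w] /= /eqP[sw] /andP[hs hw].
by exists w, s; rewrite IHl sw eqxx hw (mem_iota 1 l.+1) -sw add1n ltnS.
Qed.

Lemma exits_uniq l : uniq (exits l).
Proof.
elim: l => // l IHl; apply: allpairs_uniq_dep => //.
  by move=> *; apply: iota_uniq.
by move=> [a b] [c d] /= _ _ [-> ->].
Qed.

Lemma wraps_size u : (wraps u <= (size u).-1)%N.
Proof.
elim: u => [//|s [|s' u] IHu] //=.
by move: IHu => /=; case: (s <= s')%N => /= h; rewrite ?add0n ?add1n // ltnW.
Qed.

(** Without a crossing the exit times increase strictly from s_1 = 1, which forces s_l >= l. *)
Lemma wraps_gt0 s u : is_exits (s :: u) -> (s < (size u).+1)%N ->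
  (0 < wraps (s :: u))%N.
Proof.
elim: u s => [|s' u IHu] s /=; first by lia.
move=> /andP[h1 h2] h3; have := IHu s' h2; rewrite /=; lia.
Qed.

Lemma is_exits_drop i u : is_exits u -> is_exits (drop i u).
Proof.
by elim: u i => [|s u IHu] [|i] //= /andP[_ /IHu].
Qed.

(** Row i belongs to position n + 1 - i and column j to time n + 1 - j. For genuine exit times the
    subtraction does not truncate on the triangle, by [wraps_gt0]. *)
Definition exit_pattern (n : nat) (u : seq nat) (i j : nat) : nat :=
  (wraps (drop i.-1 u) - (nth 0%N u i.-1 < n.+1 - j))%N.

Lemma exit_rowP n u i : is_exits u -> size u = n -> (0 < i <= n)%N ->
  [/\ (0 < nth 0%N u i.-1 <= n.+1 - i)%N,
      (nth 0%N u i.-1 < n.+1 - i)%N -> (0 < wraps (drop i.-1 u))%N &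
      (i < n)%N -> wraps (drop i.-1 u) =
        ((nth 0%N u i.-1 <= nth 0%N u i) + wraps (drop i u))%N].
Proof.
move=> eu su hi.
have := is_exits_drop i.-1 eu; rewrite (drop_nth 0%N) ?su; last by lia.
have si : size (drop i u) = (n - i)%N by rewrite size_drop su.
rewrite (prednK (n := i)); last by lia.
move=> ed; split.
- by move: ed => /= /andP[]; rewrite si; lia.
- by move=> h; apply: wraps_gt0 => //; rewrite si; lia.
- by move=> h; rewrite [drop i u](drop_nth 0%N) ?su.
Qed.

Lemma wraps_last n u : size u = n -> wraps (drop n.-1 u) = 0%N.
Proof.
move=> su; apply/eqP; rewrite -leqn0.
by apply: leq_trans (wraps_size _) _; rewrite size_drop; lia.
Qed.

Lemma exit_pattern_calP n u : (0 < n)%N -> is_exits u -> size u = n ->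
  calP_cond n (exit_pattern n u).
Proof.
move=> n0 eu su; apply/calP_condP; rewrite /exit_pattern.
have R i := @exit_rowP n u i eu su.
split.
- move=> i j hij hj; have [h1 h2 h3] := R i ltac:(lia).
  have [/= h4 h5 h6] := R i.+1 ltac:(lia).
  rewrite /=.
  rewrite h3 ?leqnn; last lia.
  move: h1 h2 h4 h5 {h3 h6}; set a := nth _ _ _; set b := nth _ _ _.
  (* Here a and b are the exit times of a position and of the one before it, and W counts the
     crossings up to the latter. *)
  move: a b (wraps _) => a b W h1 h2 h4 h5; clear R eu su.
  by case: (leqP a b) h2 h5 => ? h2 h5; lia.
- move=> i j hij hj; have [h1 h2 h3] := R i ltac:(lia).
  have [/= h4 h5 h6] := R i.+1 ltac:(lia).
  rewrite /=.
  rewrite h3 ?leqnn; last lia.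
  move: h1 h2 h4 h5 {h3 h6}; set a := nth _ _ _; set b := nth _ _ _.
  move: a b (wraps _) => a b W h1 h2 h4 h5; clear R eu su.
  by case: (leqP a b) h2 h5 => ? h2 h5; lia.
- move=> i hi; have [h1 h2 h3] := R i ltac:(lia).
  have [/= h4 h5 h6] := R i.+1 ltac:(lia).
  rewrite /=.
  rewrite h3 ?leqnn; last lia.
  move: h1 h2 h4 h5 {h3 h6}; set a := nth _ _ _; set b := nth _ _ _.
  move: a b (wraps _) => a b W h1 h2 h4 h5; clear R eu su.
  by case: (leqP a b) h2 h5 => ? h2 h5; lia.
- by rewrite wraps_last.
Qed.

Lemma exit_pattern_inj n u w : is_exits u -> is_exits w ->
  size u = n -> size w = n ->
  (forall i j, (0 < i <= j)%N -> (j <= n)%N ->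
     exit_pattern n u i j = exit_pattern n w i j) ->
  u = w.
Proof.
move=> eu ew su sw e; apply: (@eq_from_nth _ 0%N); first by rewrite su.
move=> i; rewrite su => hi.
have hi1 : (0 < i.+1 <= n)%N by lia.
have [u1 u2 _] := exit_rowP eu su hi1; have [w1 w2 _] := exit_rowP ew sw hi1.
rewrite /= in u1 u2 w1 w2.
(* Column n stands for time 1, which no exit precedes, so its entry is the crossing count. *)
have eW : wraps (drop i u) = wraps (drop i w).
  have := e i.+1 n ltac:(lia) ltac:(lia); rewrite /exit_pattern /= subSnn.
  by rewrite !ltnS !leqn0; case: eqP; case: eqP; lia.
(* At the columns of the two exit times, different times would give different entries. *)
have := e i.+1 (n.+1 - nth 0%N u i)%N ltac:(lia) ltac:(lia).
have := e i.+1 (n.+1 - nth 0%N w i)%N ltac:(lia) ltac:(lia).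
rewrite /exit_pattern /= -eW !subKn; try lia.
Qed.

(** Row i increases weakly and p_(i,n) - 1 <= p_(i,i), so it takes at most two values; s marks its
    only jump. *)
Lemma calP_row n p i : calP_cond n p -> (0 < i <= n)%N ->
  exists s, [/\ (0 < s <= n.+1 - i)%N,
    (s < n.+1 - i)%N -> (0 < p i n)%N &
    forall j, (i <= j <= n)%N -> p i j = (p i n - (s < n.+1 - j))%N].
Proof.
move=> /calP_condP[h1 h2 h3 h4] hi.
have mono d j : (i <= j)%N -> (j + d <= n)%N -> (p i j <= p i (j + d))%N.
  elim: d => [|d IHd] ij jn; first by rewrite addn0.
  rewrite addnS in jn *.
  by apply: leq_trans (IHd ij (ltnW jn)) _; apply: (h1 _ _ _ _).1; lia.
have mono' j j' : (i <= j <= j')%N -> (j' <= n)%N -> (p i j <= p i j')%N.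
  by move=> hj hj'; rewrite -(subnKC (n := j') (m := j)) ?mono; lia.
have pin : (p i n - 1 <= p i i)%N.
  have [->|ne] := eqVneq i n; first by lia.
  by apply: (h3 _ _).1; lia.
have ex : exists j, (i <= j <= n)%N && (p i j == p i n).
  by exists n; rewrite eqxx andbT; lia.
case: (ex_minnP ex) => t /andP[ht /eqP et] mint.
have lt j : (i <= j < t)%N -> p i n = (p i j).+1.
  move=> hj; have := mono' i j ltac:(lia) ltac:(lia).
  have := mono' j n ltac:(lia) ltac:(lia).
  have := mint j; case: eqP => [|ne]; rewrite ?andbT; lia.
exists (n.+1 - t)%N; split; first by lia.
  by move=> h; rewrite (lt i) //; lia.
move=> j hj; case: (ltnP j t) => jt.
  by have := lt j ltac:(lia); lia.
have := mono' t j ltac:(lia) ltac:(lia).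
have := mono' j n ltac:(lia) ltac:(lia).
lia.
Qed.

(** Exit times are found from position 1 on, that is from the last row upwards: [calP_row] gives the
    new one, and [key] identifies the crossing count. *)
Lemma calP_exit_pattern n p : calP_cond n p ->
  exists u, [/\ is_exits u, size u = n &
    forall i j, (0 < i <= j)%N -> (j <= n)%N -> exit_pattern n u i j = p i j].
Proof.
move=> hp; have [h1 h2 h3 h4] := calP_condP _ _ hp.
suff H l : (l <= n)%N -> exists u, [/\ is_exits u, size u = l &
    forall i j, (n - l < i <= j)%N -> (j <= n)%N ->
      exit_pattern n u (i - (n - l)) j = p i j].
  have [u [eu su hu]] := H n (leqnn _); exists u; split=> // i j hij hj.
  by rewrite -hu ?subnn ?subn0.
elim: l => [|l IHl] ln; first by exists [::]; split=> // i j; lia.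
have [u [eu su hu]] := IHl (ltnW ln).
set i0 := (n - l)%N.
have hi0 : (0 < i0 <= n)%N by lia.
have [s [s1 s2 s3]] := calP_row hp hi0.
have esu : is_exits (s :: u) by rewrite /= eu su; lia.
have key : wraps (s :: u) = p i0 n.
  have wE j : (i0 < j <= n)%N -> p i0.+1 j = (wraps u - (head 0%N u < n.+1 - j))%N.
    move=> hj; rewrite -hu; try lia.
    rewrite /exit_pattern (_ : (_ - _).-1 = 0)%N; last by lia.
    by rewrite drop0 nth0.
  have i0E : i0 = (n - l)%N by [].
  clearbody i0; case: u eu su esu wE {hu IHl} => [_ l0|s' u eu su esu wE].
    by rewrite i0E -l0 subn0 h4.
  have s'1 : (0 < s' <= l)%N by move: eu su => /= /andP[]; lia.
  have wu0 : (s' < l)%N -> (0 < wraps (s' :: u))%N.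
    by move=> h; apply: wraps_gt0 => //; move: su => /=; lia.
  have -> : wraps (s :: s' :: u) = ((s <= s') + wraps (s' :: u))%N by [].
  move: (wraps _) wu0 wE => W wu0 /= wE.
  (* Interlacing and p_(i0,n) - 1 <= p_(i0,i0) <= p_(i0+1,n) leave only the values W and W + 1. *)
  have aW : (W <= p i0 n <= W.+1)%N.
    have := h3 i0 ltac:(lia); have := h1 i0 n.-1 ltac:(lia) ltac:(lia).
    by rewrite prednK ?wE; lia.
  move: s2 s3; have := h2 i0; have := h3 i0 ltac:(lia).
  move: (p i0 n) aW => a aW h3' h2' s2 s3.
  case: (leqP s s') => ss' /=.
    (* Interlacing at column n - s' excludes the value W. *)
    have [_] := h1 i0 (n - s')%N ltac:(lia) ltac:(lia).
    by rewrite wE ?s3; lia.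
  (* Now W + 1 is excluded: by p_(i0,i0) <= p_(i0+1,n) if s is maximal, and otherwise by p_(i0,j) -
     1 <= p_(i0+1,j) at j = n + 1 - s. *)
  have [e|ne] := eqVneq s (n.+1 - i0)%N.
    by move: h3'; rewrite s3 ?wE; lia.
  have := h2' (n.+1 - s)%N ltac:(lia) ltac:(lia).
  by rewrite wE ?s3; lia.
exists (s :: u); split=> //; first by rewrite /= su.
move=> i j hij hj; have [e|ne] := eqVneq i i0.
  have -> : (i - (n - l.+1) = 1)%N by lia.
  rewrite /exit_pattern [drop _ _]/= key e -s3 //; lia.
rewrite -hu //; last by lia.
have -> : (i - (n - l.+1) = (i - (n - l)).-1.+2)%N by lia.
have {2}-> : (i - (n - l) = (i - (n - l)).-1.+1)%N by lia.
by [].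
Qed.

End ExitTimes.

(** * From sums over patterns to sums over exit times *)

Definition exit_array (n : nat) (u : seq nat) : array n :=
  [ffun ij : 'I_n.+1 * 'I_n.+1 =>
    inord (if (0 < ij.1 <= ij.2)%N then exit_pattern n u ij.1 ij.2 else 0%N)].

Lemma entry_exit_array n u i j : size u = n -> (0 < i <= j)%N -> (j <= n)%N ->
  entry (exit_array n u) i j = exit_pattern n u i j.
Proof.
move=> su hij hj; rewrite /entry ffunE /= !inordK ?hij //; try lia.
rewrite ltnS /exit_pattern; apply: leq_trans (leq_subr _ _) _.
by apply: leq_trans (wraps_size _) _; rewrite size_drop su; lia.
Qed.

Lemma exit_array_calP n u : (0 < n)%N -> is_exits u -> size u = n ->
  exit_array n u \in calP n.
Proof.
move=> n0 eu su; rewrite inE; apply/andP; split.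
  apply: (calP_cond_ext n0 _ (exit_pattern_calP n0 eu su)) => i j hij hj.
  by rewrite entry_exit_array.
apply/forallP=> i; apply/forallP=> j; apply/implyP=> /negbTE hij.
by rewrite /entry ffunE /= !inord_val hij inordK.
Qed.

Lemma sum_calP (V : nmodType) n (g : array n -> V) : (0 < n)%N ->
  \sum_(p in calP n) g p = \sum_(u <- exits n) g (exit_array n u).
Proof.
move=> n0; rewrite -big_enum -[RHS](big_map (exit_array n) xpredT g).
apply: perm_big; apply: uniq_perm; first exact: enum_uniq.
  rewrite map_inj_in_uniq ?exits_uniq // => u w.
  rewrite !mem_exits => /andP[/eqP su eu] /andP[/eqP sw ew] e.
  apply: (exit_pattern_inj eu ew su sw) => i j hij hj.
  by rewrite -!entry_exit_array ?e.
move=> p; rewrite mem_enum; apply/idP/mapP => [hp|[u]]; last first.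
  by rewrite mem_exits => /andP[/eqP su eu] ->; apply: exit_array_calP.
have := hp; rewrite inE => /andP[/calP_exit_pattern[u [eu su hu]] _].
exists u; first by rewrite mem_exits su eqxx.
apply: calP_inj => //; first exact: exit_array_calP.
by move=> i j hij hj; rewrite entry_exit_array // hu.
Qed.

(** * Weights as products over positions *)

Section Weights.

Variables (R : comNzRingType).

Fixpoint walk_weight (y : nat -> nat -> R) (x : R) (u : seq nat) : R :=
  if u is s :: u' then
    (if u' is s' :: _ then transfer y x (size u) s' s else 1) *
    walk_weight y x u'
  else 1.

Lemma walks_exits (y : nat -> nat -> R) (x : R) l s :
  walks y x l s = \sum_(u <- exits l) walk_weight y x (s :: u).
Proof.
elim: l s => [|l IHl] s; first by rewrite big_seq1 /= mulr1.
rewrite walks_rec exitsS big_allpairs_dep /= exchange_big /=.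
rewrite /index_iota subn1; apply: eq_big_seq => s' _.
rewrite IHl mulr_suml big_seq_cond [RHS]big_seq_cond; apply: eq_bigr => u.
rewrite mem_exits => /andP[/andP[/eqP su _] _].
by rewrite mulrC /= su.
Qed.

(** The weight of a pattern with one factor per position, as induction on u needs it; h will be
    [phi z]. *)
Fixpoint exit_weight (h : nat -> nat -> R) (u : seq nat) : R :=
  if u is s :: u' then
    (\prod_(1 <= b < (size u).+1) h b (size u) ^+ (wraps u - (s < b))) *
    exit_weight h u'
  else 1.

Lemma exit_weightE (h : nat -> nat -> R) u : exit_weight h u =
  \prod_(0 <= i < size u) \prod_(1 <= b < (size u - i).+1)
    h b (size u - i)%N ^+ (wraps (drop i u) - (nth 0%N u i < b)).
Proof.
elim: u => [|s u IHu]; first by rewrite big_geq.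
by rewrite [LHS]/= IHu [RHS]big_nat_recl //= drop0.
Qed.

Lemma prod_nat_rev (g : nat -> R) i k : (i < k)%N ->
  \prod_(i <= j < k) g (k - j)%N = \prod_(1 <= b < (k - i).+1) g b.
Proof.
move=> ik; rewrite big_nat_rev /= -{1}[i]add0n big_addn [RHS]big_add1 /=.
by apply: eq_big_nat => j hj; congr g; lia.
Qed.

End Weights.

(** * Telescoping of the weights *)

Section Main.

Variables (F : fieldType) (z : nat -> nat -> F) (m : nat).
Hypothesis hz : forall j i : nat, (1 <= j <= i)%N -> (i <= m)%N -> z j i != 0.

Local Notation y := (Wcoord z).

Lemma wt_exit_array n u : size u = n ->
  wt z (k := n.+1) (exit_array n u) = exit_weight (phi z) u.
Proof.
move=> su; rewrite exit_weightE su /wt [LHS]big_add1 /=.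
apply: eq_big_nat => i hi.
rewrite -(subSS i n) -(prod_nat_rev (fun b => phi z b (n.+1 - i.+1)%N ^+
  (wraps (drop i u) - (nth 0%N u i < b)))) //.
by apply: eq_big_nat => j hj; rewrite entry_exit_array // /exit_pattern; lia.
Qed.

Lemma beta_colprod i : (0 < i)%N -> beta z i = colprod y i.
Proof.
case: i => // i _; rewrite /beta /colprod [X in X / _]big_nat_recr //.
rewrite [RHS]big_nat_recr //= /Wcoord eqxx mulrAC -prodf_div; congr (_ * _).
by apply: eq_big_nat => a ha; have -> : (i.+1 == a) = false by lia.
Qed.

Lemma Wcoord_neq0 a l : (1 <= a <= l)%N -> (l <= m)%N -> y a l != 0.
Proof.
move=> hal lm; rewrite /Wcoord; case: (eqVneq l) => e; first by apply: hz; lia.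
by apply: mulf_neq0; rewrite ?invr_eq0; apply: hz; lia.
Qed.

(** With [phiSE], this is the source of the telescoping: phi trades factors y of position l + 1 for
    factors of position l. The case b = 1 absorbs both end factors. *)
Lemma phi1E l : (0 < l < m)%N -> phi z 1 l * (y 1 l.+1 * y l.+1 l.+1) = y l l.
Proof.
move=> hl; rewrite /phi /Wcoord !eqxx.
have -> : (l.+1 == 1)%N = false by lia.
by field; rewrite !hz //; lia.
Qed.

Lemma phiSE b l : (0 < b < l)%N -> (l < m)%N ->
  phi z b.+1 l * y b.+1 l.+1 = y b l.
Proof.
move=> hb lm; rewrite /phi /Wcoord.
have -> : (b.+1 == 1)%N = false by lia.
have -> : (l.+1 == b.+1)%N = false by lia.
have -> : (l == b)%N = false by lia.
by field; rewrite /= !hz //; lia.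
Qed.

Lemma prod_phi_tail s l : (0 < s <= l)%N -> (l < m)%N ->
  (\prod_(s.+1 <= b < l.+1) phi z b l) * (\prod_(s.+1 <= a < l.+1) y a l.+1) =
  \prod_(s <= a < l) y a l.
Proof.
move=> hs lm; rewrite -big_split big_add1 /=.
by apply: eq_big_nat => b hb; rewrite phiSE //; lia.
Qed.

Lemma prod_phi l : (0 < l < m)%N ->
  (\prod_(1 <= b < l.+1) phi z b l) * colprod y l.+1 = colprod y l.
Proof.
move=> hl; rewrite /colprod.
have tail := @prod_phi_tail 1 l ltac:(lia) ltac:(lia).
rewrite [X in X * _]big_ltn; last lia.
rewrite [X in _ * X = _]big_ltn //.
rewrite [X in _ * (_ * X) = _]big_nat_recr; last lia.
rewrite [RHS]big_nat_recr /=; last lia.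
by rewrite -tail -(phi1E hl) //; ring.
Qed.

(** The exponents W - [s < b] give the W-th power of all phi, which turns colprod (l + 1) into
    colprod l, divided by the phi with b > s, which [prod_phi_tail] evaluates. *)
Lemma exit_row_weight s l W : (0 < s <= l)%N -> (l < m)%N ->
  ((s < l)%N -> (0 < W)%N) ->
  (\prod_(1 <= b < l.+1) phi z b l ^+ (W - (s < b))) * colprod y l.+1 ^+ W *
    (\prod_(s <= a < l) y a l) =
  colprod y l ^+ W * \prod_(s.+1 <= a < l.+1) y a l.+1.
Proof.
move=> hs lm hW; rewrite -prod_phi_tail // -(@prod_phi l); last by lia.
have E : (\prod_(1 <= b < l.+1) phi z b l ^+ (W - (s < b))) *
    (\prod_(s.+1 <= b < l.+1) phi z b l) =
    (\prod_(1 <= b < l.+1) phi z b l) ^+ W.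
  rewrite -prodrXl (big_cat_nat _ (n := s.+1)) //=; last lia.
  rewrite [RHS](big_cat_nat _ (n := s.+1)) //=; last lia.
  rewrite -mulrA -big_split /=; congr (_ * _); apply: eq_big_nat => b hb.
    by rewrite (_ : (s < b)%N = false) ?subn0 //; lia.
  have -> : (s < b)%N by lia.
  by rewrite -exprSr; congr (_ ^+ _); lia.
by rewrite exprMn -E; ring.
Qed.

(** Once the times from s to l - 1 are filled in, the weight depends on s only through the passage
    of the seam. *)
Lemma transfer_row x l s' s : (0 < s' < l)%N -> (0 < s <= l)%N ->
  transfer y x l s' s * (\prod_(s <= a < l) y a l) =
  (\prod_(s'.+1 <= a < l) y a l) * (if (s <= s')%N then colprod y l else x).
Proof.
move=> hs' hs; rewrite /transfer /colprod; case: leqP => ss'.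
  rewrite [X in _ * X * _]big_nat_recr /=; last lia.
  rewrite [X in _ = _ * X]big_nat_recr /=; last lia.
  by rewrite [X in _ = _ * (X * _)](big_cat_nat _ (n := s)) /=; [ring|lia|lia].
by rewrite [X in _ = X * _](big_cat_nat _ (n := s)) /=; [ring|lia|lia].
Qed.

(** Invariant of the telescoping at position l = size u + 1: the factors of position l + 1 on both
    sides are left over for the next step. Each of the [size u] positions after the first gives
    either a crossing or a factor x. *)
Lemma exit_weight_walk x s u : is_exits (s :: u) -> (size u < m.-1)%N ->
  x ^+ (size u - wraps (s :: u)) * exit_weight (phi z) (s :: u) *
    colprod y (size u).+2 ^+ wraps (s :: u) =
  walk_weight y x (s :: u) * \prod_(s.+1 <= a < (size u).+2) y a (size u).+2.
Proof.
elim: u s => [|s' u IHu] s esu um.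
  have -> : s = 1%N by move: esu => /=; lia.
  by rewrite /= big_nat1 expr0 !(mulr1, mul1r) expr0 big_geq.
set l := (size (s' :: u)).+1 in um *.
have eu : is_exits (s' :: u) by move: esu => /= /andP[].
have hs : (0 < s <= l)%N by move: esu => /= /andP[].
have hs' : (0 < s' < l)%N by move: eu => /= /andP[]; rewrite /l /=; lia.
have lm : (l < m)%N by rewrite /l; lia.
have IH := IHu s' eu (ltn_trans (ltnSn _) um).
have W1 : wraps (s :: s' :: u) = ((s <= s') + wraps (s' :: u))%N by [].
have W2 := wraps_size (s' :: u).
have W3 := @wraps_gt0 s (s' :: u) esu.
have Pi0 : \prod_(s <= a < l) y a l != 0.
  rewrite prodf_seq_neq0; apply/allP=> a; rewrite mem_index_iota => ha /=.
  by apply: Wcoord_neq0; lia.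
(* Both sides are multiplied by the product that occurs in [exit_row_weight] and [transfer_row]. *)
apply: (mulIf Pi0).
have R := @exit_row_weight s l (wraps (s :: s' :: u)) hs lm W3.
have T := @transfer_row x l s' s hs' hs.
have -> : exit_weight (phi z) (s :: s' :: u) =
  (\prod_(1 <= b < l.+1) phi z b l ^+ (wraps (s :: s' :: u) - (s < b))) *
  exit_weight (phi z) (s' :: u) by [].
have -> : walk_weight y x (s :: s' :: u) =
  transfer y x l s' s * walk_weight y x (s' :: u) by [].
have -> : size (s' :: u) = (size u).+1 by [].
transitivity (x ^+ ((size u).+1 - wraps (s :: s' :: u)) *
    exit_weight (phi z) (s' :: u) * (colprod y l ^+ wraps (s :: s' :: u) *
    \prod_(s.+1 <= a < l.+1) y a l.+1)); first by rewrite -R; ring.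
transitivity (\prod_(s.+1 <= a < l.+1) y a l.+1 *
  (if (s <= s')%N then colprod y l else x) *
  (walk_weight y x (s' :: u) * \prod_(s'.+1 <= a < l) y a l)); last first.
  rewrite [RHS]mulrAC [X in _ = X * _]mulrAC T; ring.
rewrite /l -IH W1; case: leqP => _ /=.
  by rewrite add1n subSS exprS; ring.
rewrite add0n subSn ?exprS; first by ring.
exact: W2.
Qed.

(** At x = colprod k the powers in [exit_weight_walk] merge into beta_k^(k-2) for every walk; the
    stay at k until time k supplies the last factor y k k = z k k. *)
Lemma exit_sum_walks k : (2 <= k <= m)%N ->
  beta z k ^+ (k - 2) * z k k * \sum_(p in calP k.-1) wt z p =
  walks y (beta z k) k.-1 1.
Proof.
case: k => [//|[//|k]] hk; rewrite sum_calP // walks_exits mulr_sumr.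
rewrite big_seq [RHS]big_seq; apply: eq_bigr => u.
rewrite mem_exits => /andP[/eqP su eu].
rewrite wt_exit_array // beta_colprod // (_ : k.+2 - 2 = k)%N; last lia.
case: u su eu => [//|s u] [su] eu.
have hs : (0 < s <= k.+1)%N by move: eu => /= /andP[]; rewrite su.
have := @exit_weight_walk (colprod y k.+2) s u eu.
rewrite su => /(_ ltac:(lia)) E.
have W := wraps_size (s :: u).
have -> : walk_weight y (colprod y k.+2) (1%N :: s :: u) =
  transfer y (colprod y k.+2) k.+2 s 1 *
  walk_weight y (colprod y k.+2) (s :: u) by rewrite -su.
rewrite /transfer; have -> : (0 < s)%N by lia.
rewrite big_geq // mul1r big_nat_recr /=; last lia.
rewrite [X in _ = _ * X * _]/Wcoord eqxx mulrAC [RHS]mulrAC.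
congr (_ * _); rewrite [RHS]mulrC -E mulrAC -exprD subnK //.
by move: W; rewrite /= su.
Qed.

End Main.

Theorem proposition7p17 (F : fieldType) (m : nat) (z : nat -> nat -> F)
    (hm : (2 <= m)%N)
    (hz : forall j i : nat, (1 <= j <= i)%N -> (i <= m)%N -> z j i != 0)
    (k : nat) (hk : (2 <= k <= m)%N) :
  sigma m z k =
    beta z k ^+ (k - 2) * z k k * \sum_(p in calP k.-1) wt z p.
Proof. by rewrite sigma_walks // (exit_sum_walks hz). Qed.
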